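(* Let $T$ be a tree rooted at $o$, let $X$ be either $\mathcal{L}_{\mathbf{w}}$ or $\mathcal{L}_{\mathbf{w},0}$, and let $\psi:T\to\mathbb{C}$ be such that $M_\psi$ is bounded on $X$. Then the essential norm of $M_\psi$ on $X$ satisfies $$\|M_\psi\|_e\ge\max\{A(\psi),B(\psi)\},$$ where $A(\psi)=\lim_{n\to\infty}\sup_{|v|\ge n}|\psi(v)|$ and $B(\psi)=\lim_{n\to\infty}\sup_{|v|\ge n}|v|\log|v|\,D\psi(v)$.
   Context: A tree $T$ is a locally finite, connected, simply-connected graph, identified with its set of vertices; $T$ is assumed to have no terminal vertices (vertices with exactly one neighbor), so it is infinite, and it is rooted at a vertex $o$. $|v|$ is the number of edges in the unique path from $o$ to $v$; $T^*=T\setminus\{o\}$; for $v\in T^*$, $v^-$ is the neighbor of $v$ closest to $o$. For $f:T\to\mathbb{C}$ and $v\in T^*$, $Df(v)=|f(v)-f(v^-)|$. The weighted Lipschitz space $\mathcal{L}_{\mathbf{w}}$ is the set of $f:T\to\mathbb{C}$ with $\sup_{v\in T^*}|v|Df(v)<\infty$, normed by $\|f\|_{\mathbf{w}}=|f(o)|+\sup_{v\in T^*}|v|Df(v)$ (a Banach space). The little weighted Lipschitz space $\mathcal{L}_{\mathbf{w},0}$ is the closed subspace of those $f\in\mathcal{L}_{\mathbf{w}}$ with $\lim_{|v|\to\infty}|v|Df(v)=0$. $M_\psi f=\psi f$ (pointwise product); ''$M_\psi$ is bounded on $X$'' means $M_\psi$ maps $X$ into $X$ and is a bounded linear operator there.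 The essential norm of a bounded operator $S$ on a Banach space $X$ is $\|S\|_e=\inf\{\|S-K\|: K\text{ compact operator on }X\}$. *)

(* Defs.v *)
From HB Require Import structures.
From mathcomp Require Import all_boot all_order all_algebra.
From mathcomp Require Import all_classical all_reals all_analysis.
From mathcomp Require Import complex.
Set Implicit Arguments.
Unset Strict Implicit.
Unset Printing Implicit Defensive.
Import Order.TTheory GRing.Theory Num.Theory.
Import numFieldNormedType.Exports.
Local Open Scope classical_set_scope.
Local Open Scope complex_scope.
Local Open Scope ring_scope.

(* The norm of a normed space over R[i] takes its values in R[i] (on the
   nonnegative real axis); rnorm reads it as an element of R. *)
Definition rnorm (R : realType) (V : normedZmodType R[i]) (x : V) : R :=
  complex.Re `|x|.

Section rnorm_theory.
Context {R : realType} {V : normedZmodType R[i]}.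
Implicit Types x y : V.

Lemma rnormE x : (rnorm x)%:C = `|x|.
Proof. by apply: RRe_real; apply: ger0_real. Qed.

Lemma rnorm_ge0 x : 0 <= rnorm x.
Proof. by rewrite -lecR rnormE; exact: normr_ge0. Qed.

Lemma rnormD x y : rnorm (x + y) <= rnorm x + rnorm y.
Proof. by rewrite -lecR rmorphD/= !rnormE ler_normD. Qed.

Lemma rnorm0_eq0 x : rnorm x = 0 -> x = 0.
Proof. by move=> x0; apply/eqP; rewrite -normr_eq0 -rnormE x0. Qed.

Lemma rnorm0 : rnorm (0 : V) = 0.
Proof. by rewrite /rnorm normr0. Qed.

End rnorm_theory.

Lemma rnormM (R : realType) (x y : R[i]) : rnorm (x * y) = rnorm x * rnorm y.
Proof. by apply: (fmorph_inj (real_complex R)); rewrite rmorphM/= !rnormE normrM. Qed.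

Section operators.
Context {R : realType} {V : normedModType R[i]}.

Definition bounded_operator (S : V -> V) : Prop :=
  exists M : R, forall x, rnorm (S x) <= M * rnorm x.

Definition compact_operator (K : V -> V) : Prop :=
  precompact (K @` [set x | rnorm x <= 1]).

Local Open Scope ereal_scope.

Definition operator_norm (S : V -> V) : \bar R :=
  ereal_sup [set (rnorm (S x))%:E | x in [set x | (rnorm x <= 1)%R]].

Definition essential_norm (S : V -> V) : \bar R :=
  ereal_inf [set operator_norm (S \- K)%R
            | K in [set K : {linear V -> V} | compact_operator K]].

End operators.

(* A connected graph is simply connected when it has no cycle; with adj
   symmetric, a simple adj-cycle of size 2 is a single edge traversed back and
   forth.  The last field rules out the one-vertex graph. *)
Record rooted_tree := RootedTree {
  vertex :> choiceType;
  adj : rel vertex;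
  root : vertex;
  adj_sym : symmetric adj;
  adj_irr : irreflexive adj;
  adj_locally_finite : forall v, finite_set [set w | adj v w];
  adj_connected : forall u v, exists p, path adj u p /\ last u p = v;
  adj_acyclic : forall c, cycle adj c -> uniq c -> (size c <= 2)%N;
  adj_no_terminal : forall v, ~ exists w, [set u | adj v u] = [set w];
  adj_infinite : infinite_set [set: vertex] }.

Arguments root {r}.

Section tree_level.
Context {T : rooted_tree}.
Implicit Types u v w : T.

Definition simple_path u v : set (seq T) :=
  [set p | [/\ path (@adj T) u p, last u p = v & uniq (u :: p)]].

Definition level v : nat := size (xget [::] (simple_path root v)).

(* v^-; only meaningful for v != root. *)
Definition parent v : T :=
  xget v [set u | adj v u /\ forall w, adj v w -> (level u <= level w)%N].

Lemma simple_path_ex u v : simple_path u v !=set0.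
Proof.
have [p [+ <-]] := adj_connected u v.
by case/shortenP=> q pq uq _; exists q.
Qed.

Lemma simple_path_unique u v p q :
  simple_path u v p -> simple_path u v q -> p = q.
Proof.
elim: p u q => [|a p IH] u q.
  move=> [_ /= <- _] [_ lq uq]; case: q lq uq => // b q /= lq /andP[].
  by rewrite -{1}lq mem_last.
case: q => [|b q].
  by move=> [_ /= lp /andP[]] + _ [_ /= uv _]; rewrite uv -lp mem_last.
move=> [/= /andP[ua pp] lp /andP[up upp]] [/= /andP[ub pq] lq /andP[uq uqq]].
have [ab|ab] := eqVneq a b.
  by subst b; congr (_ :: _); apply: (IH a).
exfalso.
have hasz : has (mem (b :: q)) (a :: p).
  apply/hasP; exists v; first by rewrite -lp mem_last.
  by rewrite /= -lq mem_last.
have [z [p1 [p2 [defp zq disj]]]] : exists z p1 p2, [/\ p1 ++ z :: p2 = a :: p,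
    z \in b :: q & forall w, w \in p1 -> w \notin b :: q].
  case: (split_find hasz) => z p1 p2 zq /hasPn disj.
  by exists z, p1, p2; rewrite cat_rcons.
have [q1 [q2 defq]] : exists q1 q2, b :: q = q1 ++ z :: q2.
  by case/splitPr: zq => q1 q2; exists q1, q2.
have ppath : path (@adj T) u (p1 ++ z :: p2) by rewrite defp /= ua.
have qpath : path (@adj T) u (q1 ++ z :: q2) by rewrite -defq /= ub.
have := @adj_acyclic T (u :: p1 ++ z :: rev q1).
have cyc : cycle (@adj T) (u :: p1 ++ z :: rev q1).
  move: ppath qpath; rewrite /cycle rcons_cat !cat_path /=.
  move=> /and3P[-> -> _] /and3P[q1p q1z _] /=.
  rewrite -[path _ _ _]/(path (@adj T) z (rcons (rev q1) u)) -rev_cons.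
  have -> : z = last u (rcons q1 z) by rewrite last_rcons.
  have -> : u :: q1 = belast u (rcons q1 z) by rewrite belast_rcons.
  rewrite rev_path (eq_path (e' := @adj T)).
    by rewrite rcons_path q1p.
  by move=> x y; rewrite adj_sym.
have uniqc : uniq (u :: p1 ++ z :: rev q1).
  have unip : uniq (u :: p1 ++ z :: p2) by rewrite defp /= up.
  have uniqq : uniq (u :: q1 ++ z :: q2) by rewrite -defq /= uq.
  move: unip uniqq; rewrite /= !mem_cat !inE !negb_or !cat_uniq /= !negb_or.
  move=> /and3P[/and3P[-> -> _] -> /and3P[/andP[-> _] _ _]].
  move=> /and3P[/and3P[uq1 _ _] uq1' /and3P[/andP[zq1 _] _ _]].
  rewrite !mem_rev uq1 zq1 rev_uniq uq1' /= andbT.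
  apply/hasPn => w; rewrite mem_rev => wq1; apply/negP => /disj.
  by rewrite defq mem_cat wq1.
move=> /(_ cyc uniqc); rewrite /= size_cat /= size_rev.
case: p1 defp {disj ppath cyc uniqc} => [|? ?]; last by rewrite addSn addnS.
case: q1 defq {qpath} => [|? ?]; last by rewrite addnS.
by move=> [zb _] [za _] _; move: ab; rewrite -za -zb eqxx.
Qed.

Lemma level_path v p : simple_path root v p -> size p = level v.
Proof.
move=> vp; rewrite /level; congr size.
by apply: (simple_path_unique vp); apply: xgetI vp.
Qed.

Lemma level_pred v : v != root ->
  exists u, adj v u /\ (level u < level v)%N.
Proof.
move=> v0; have [p vp] := simple_path_ex root v.
rewrite -(level_path vp).
case: vp; elim/last_ind: p => [_ /= rv|p w _]; first by rewrite rv eqxx in v0.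
rewrite last_rcons rcons_path => /andP[pp pw] wv; subst w.
rewrite -rcons_cons rcons_uniq => /andP[_ up].
exists (last root p); rewrite adj_sym pw size_rcons.
by split => //; rewrite -(@level_path (last root p) p).
Qed.

Lemma parentP v : v != root ->
  adj v (parent v) /\ (level (parent v) < level v)%N.
Proof.
move=> v0; have [u [vu luv]] := level_pred v0.
suff /(xgetPex v) [vp plow] : exists u,
    adj v u /\ forall w, adj v w -> (level u <= level w)%N.
  by split=> //; apply: leq_ltn_trans luv; exact: plow.
have ex : exists n, `[< exists2 w, adj v w & level w = n >].
  by exists (level u); apply/asboolP; exists u.
case: (ex_minnP ex) => n /asboolP[w vw wn] nmin.
exists w; split=> // w' vw'; rewrite wn; apply: nmin.
by apply/asboolP; exists w'.
Qed.

End tree_level.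

Section lipschitz.
Context (R : realType) (T : rooted_tree).
Implicit Types (f g : T -> R[i]) (v : T).

Definition Dtree f v : R := rnorm (f v - f (parent v)).

Definition wD f v : R := (level v)%:R * Dtree f v.

Definition wD_set f : set R := [set wD f v | v in [set v | v != root]].

Definition wnorm f : R := rnorm (f root) + sup (wD_set f).

(* The filter of complements of balls, along which |v| tends to oo. *)
Definition tree_oo : set_system T :=
  filter_from [set: nat] (fun n => [set v : T | (n <= level v)%N]).

#[global] Instance tree_oo_filter : Filter tree_oo.
Proof.
apply: filter_from_filter; first by exists 0%N.
move=> i j _ _; exists (maxn i j) => // v /=.
by rewrite geq_max => /andP[].
Qed.

Definition Lw_pred : {pred (T -> R[i])} :=
  [pred f | `[< has_ubound (wD_set f) >]].

Definition Lw0_pred : {pred (T -> R[i])} :=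
  [pred f | (f \in Lw_pred) && `[< wD f @ tree_oo --> (0 : R) >]].

Lemma wD_ge0 f v : 0 <= wD f v.
Proof. by rewrite mulr_ge0 ?ler0n// rnorm_ge0. Qed.

Lemma wDD f g v : wD (f + g) v <= wD f v + wD g v.
Proof.
rewrite /wD /Dtree -mulrDr ler_wpM2l//.
rewrite -[X in rnorm X <= _]/(f v + g v - (f (parent v) + g (parent v))).
by rewrite opprD addrACA rnormD.
Qed.

Lemma wDZ a f v : wD (a *: f) v = rnorm a * wD f v.
Proof. by rewrite /wD /Dtree mulrCA -rnormM mulrBr. Qed.

Lemma wD0 v : wD 0 v = 0.
Proof. by rewrite /wD /Dtree -[X in rnorm X]/(0 - 0 : R[i]) subrr rnorm0 mulr0. Qed.

Lemma Lw_pred_submod : submod_closed Lw_pred.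
Proof.
split.
  by apply/asboolP; exists 0 => _ [v _ <-]; rewrite wD0.
move=> a f g /asboolP[M fM] /asboolP[N gN]; apply/asboolP.
exists (rnorm a * M + N) => _ [v v0 <-].
rewrite (le_trans (wDD _ _ _))// wDZ lerD//; last by apply: gN; exists v.
by rewrite ler_wpM2l ?rnorm_ge0//; apply: fM; exists v.
Qed.

Lemma Lw0_pred_submod : submod_closed Lw0_pred.
Proof.
have [p0 pD] := Lw_pred_submod; split.
  apply/andP; split => //; apply/asboolP.
  by rewrite (_ : wD 0 = cst 0); [exact: cvg_cst|apply/funext => v; rewrite wD0].
move=> a f g /andP[fL /asboolP f0] /andP[gL /asboolP g0].
apply/andP; split; first exact: pD.
apply/asboolP.
have h0 : (fun v => rnorm a * wD f v + wD g v) @ tree_oo --> (0 : R).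
  rewrite [X in _ --> X](_ : _ = rnorm a * 0 + 0); last by rewrite mulr0 addr0.
  by apply: cvgD => //; apply: cvgMr.
apply: (@squeeze_cvgr _ _ _ _ (cst 0) _ _ _ 0 _ h0); last exact: cvg_cst.
by apply: nearW => v; rewrite wD_ge0 /= (le_trans (wDD _ _ _))// wDZ.
Qed.

Lemma wD_set_nonempty f : wD_set f !=set0.
Proof.
suff [v v0] : exists v : T, v != root by exists (wD f v), v.
apply: contrapT => /forallNP no; apply: (@adj_infinite T).
apply: (sub_finite_set _ (finite_set1 (@root T))) => v _ /=.
by have /negP := no v; rewrite negbK => /eqP.
Qed.

Lemma wD_le_sup f v : f \in Lw_pred -> v != root -> wD f v <= sup (wD_set f).
Proof.
move=> /asboolP fL v0; apply: ub_le_sup => //; last by exists v.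
Qed.

Lemma sup_wD_ge0 f : f \in Lw_pred -> 0 <= sup (wD_set f).
Proof.
move=> fL; have [_ [v v0 _]] := wD_set_nonempty f.
exact: le_trans (wD_ge0 f v) (wD_le_sup fL v0).
Qed.

Lemma wnormD f g : f \in Lw_pred -> g \in Lw_pred ->
  wnorm (f + g) <= wnorm f + wnorm g.
Proof.
move=> fL gL; rewrite /wnorm addrACA lerD ?rnormD//.
apply: ge_sup; first exact: wD_set_nonempty.
by move=> _ [v v0 <-]; rewrite (le_trans (wDD _ _ _))// lerD ?wD_le_sup.
Qed.

Lemma wnormZ a f : f \in Lw_pred -> wnorm (a *: f) = rnorm a * wnorm f.
Proof.
move=> fL; have sub b h : h \in Lw_pred ->
    sup (wD_set (b *: h)) <= rnorm b * sup (wD_set h).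
  move=> hL; apply: ge_sup; first exact: wD_set_nonempty.
  move=> _ [v v0 <-]; rewrite wDZ ler_wpM2l ?rnorm_ge0//.
  exact: wD_le_sup.
rewrite /wnorm mulrDr -rnormM; congr (_ + _).
apply/eqP; rewrite eq_le sub//=.
have [->|a0] := eqVneq a 0.
  rewrite rnorm0 mul0r sup_wD_ge0//; have [p0 pD] := Lw_pred_submod.
  by rewrite scale0r.
have aL : a *: f \in Lw_pred.
  have [p0 pD] := Lw_pred_submod.
  by have := pD a f 0 fL p0; rewrite addr0.
have := sub a^-1 _ aL; rewrite scalerA mulVf// scale1r.
have a_gt0 : 0 < rnorm a.
  rewrite lt_neqAle rnorm_ge0 andbT eq_sym; apply: contra_neq a0.
  exact: rnorm0_eq0.
move=> /(ler_wpM2l (ltW a_gt0)); rewrite mulrA -rnormM divff//.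
by rewrite (_ : rnorm (1 : R[i]) = 1) ?mul1r// /rnorm normr1.
Qed.

Lemma wnorm_eq0 f : f \in Lw_pred -> wnorm f = 0 -> f = 0.
Proof.
move=> fL /eqP; rewrite paddr_eq0 ?rnorm_ge0 ?sup_wD_ge0// => /andP[].
move=> /eqP/rnorm0_eq0 f0 /eqP sup0; apply/funext => v.
have [n] := ubnP (level v); elim: n v => // n IH v lvn.
have [->|v0] := eqVneq v root; first by [].
have [_ plt] := parentP v0.
have lv : 0 < (level v)%:R :> R by rewrite ltr0n (leq_ltn_trans _ plt).
have := wD_le_sup fL v0; rewrite sup0 /wD pmulr_rle0// => D0.
have /eqP : Dtree f v = 0 by apply/eqP; rewrite eq_le D0 rnorm_ge0.
move=> /eqP/rnorm0_eq0/subr0_eq ->; apply: IH.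
exact: leq_trans plt lvn.
Qed.

HB.instance Definition _ :=
  GRing.isSubmodClosed.Build _ _ Lw_pred Lw_pred_submod.
HB.instance Definition _ :=
  GRing.isSubmodClosed.Build _ _ Lw0_pred Lw0_pred_submod.

Record Lw := MkLw { Lw_fun :> T -> R[i] ; Lw_funP : Lw_fun \in Lw_pred }.
HB.instance Definition _ := [isSub for Lw_fun].
HB.instance Definition _ := [Choice of Lw by <:].
HB.instance Definition _ := [SubChoice_isSubLmodule of Lw by <:].

Record Lw0 := MkLw0 { Lw0_fun :> T -> R[i] ; Lw0_funP : Lw0_fun \in Lw0_pred }.
HB.instance Definition _ := [isSub for Lw0_fun].
HB.instance Definition _ := [Choice of Lw0 by <:].
HB.instance Definition _ := [SubChoice_isSubLmodule of Lw0 by <:].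

Lemma Lw0_Lw (f : Lw0) : (f : T -> R[i]) \in Lw_pred.
Proof. by have /andP[] := Lw0_funP f. Qed.

Let Lw_norm (f : Lw) : R[i] := (wnorm f)%:C.
Let Lw_normD (f g : Lw) : Lw_norm (f + g) <= Lw_norm f + Lw_norm g.
Proof. by rewrite /Lw_norm -rmorphD lecR wnormD ?Lw_funP. Qed.
Let Lw_normZ a (f : Lw) : Lw_norm (a *: f) = `|a| * Lw_norm f.
Proof. by rewrite /Lw_norm [wnorm _]wnormZ ?Lw_funP// rmorphM/= rnormE. Qed.
Let Lw_norm_eq0 (f : Lw) : Lw_norm f = 0 -> f = 0.
Proof.
by move=> [f0]; apply: val_inj; apply: wnorm_eq0 f0; exact: Lw_funP.
Qed.

HB.instance Definition _ :=
  Lmodule_isNormed.Build R[i] Lw Lw_normD Lw_normZ Lw_norm_eq0.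

Let Lw0_norm (f : Lw0) : R[i] := (wnorm f)%:C.
Let Lw0_normD (f g : Lw0) : Lw0_norm (f + g) <= Lw0_norm f + Lw0_norm g.
Proof. by rewrite /Lw0_norm -rmorphD lecR wnormD ?Lw0_Lw. Qed.
Let Lw0_normZ a (f : Lw0) : Lw0_norm (a *: f) = `|a| * Lw0_norm f.
Proof. by rewrite /Lw0_norm [wnorm _]wnormZ ?Lw0_Lw// rmorphM/= rnormE. Qed.
Let Lw0_norm_eq0 (f : Lw0) : Lw0_norm f = 0 -> f = 0.
Proof.
by move=> [f0]; apply: val_inj; apply: wnorm_eq0 f0; exact: Lw0_Lw.
Qed.

HB.instance Definition _ :=
  Lmodule_isNormed.Build R[i] Lw0 Lw0_normD Lw0_normZ Lw0_norm_eq0.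

Lemma rnorm_LwE (f : Lw) : rnorm f = wnorm f.
Proof. by []. Qed.

Lemma rnorm_Lw0E (f : Lw0) : rnorm f = wnorm f.
Proof. by []. Qed.

Local Open Scope ereal_scope.

Definition Apsi (psi : T -> R[i]) : \bar R :=
  limn (fun n => ereal_sup
    [set (rnorm (psi v))%:E | v in [set v | (n <= level v)%N]]).

Definition Bpsi (psi : T -> R[i]) : \bar R :=
  limn (fun n => ereal_sup
    [set ((level v)%:R * ln (level v)%:R * Dtree psi v)%:E
    | v in [set v | (n <= level v)%N]]).

End lipschitz.

(* Main.v *)
(* If K is compact, then K is uniformly small on the functions of the unit ball
   whose derivative is supported far from the root: otherwise, functions f_i
   with derivatives supported in disjoint annuli would have all their finite
   sums in the unit ball, while their images K f_i cluster at a nonzero point.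
   For such f, ||M - K|| >= ||M f|| - ||K f|| is nearly |w| D(psi f)(w) at any
   vertex w.  For A one takes f = chi_w / (|w| + 1).  For B one takes the radial
   function with increment 1/k at the levels N < k < |w|: it has the same
   value, at least log |w| - N, at w and at its parent, so that
   |w| D(psi f)(w) >= |w| (log |w| - N) D psi(w). *)
Require Import Defs.
From mathcomp Require Import all_boot all_order all_algebra.
From mathcomp Require Import all_classical all_reals all_analysis.
From mathcomp Require Import complex lra.
Import Order.TTheory GRing.Theory Num.Theory.
Import numFieldNormedType.Exports.
Local Open Scope ring_scope.

(* The unqualified name is shadowed by the roots of polynomials. *)
Local Notation root := Defs.root.

(** * Real-valued norms on spaces over the complex numbers *)

Section Rnorm.
Context {R : realType} {V : normedZmodType R[i]}.
Implicit Types x y : V.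

Lemma rnormN x : rnorm (- x) = rnorm x.
Proof. by rewrite /rnorm normrN. Qed.

Lemma rnorm_distrC x y : rnorm (x - y) = rnorm (y - x).
Proof. by rewrite -rnormN opprB. Qed.

Lemma rnorm_triangle x y : rnorm x <= rnorm (x - y) + rnorm y.
Proof. by rewrite -{1}(subrK y x) rnormD. Qed.

Lemma rnorm_sum (I : Type) (s : seq I) (F : I -> V) :
  rnorm (\sum_(i <- s) F i) <= \sum_(i <- s) rnorm (F i).
Proof.
elim: s => [|i s IHs]; first by rewrite !big_nil rnorm0.
by rewrite !big_cons (le_trans (rnormD _ _))// lerD2l.
Qed.

Lemma rnormMn x n : rnorm (x *+ n) = rnorm x *+ n.
Proof.
apply: (fmorph_inj (real_complex R)).
by rewrite rmorphMn/= !rnormE normrMn.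
Qed.

End Rnorm.

Lemma rnorm_real (R : realType) (x : R) : rnorm x%:C%C = `|x|.
Proof. by rewrite /rnorm normc_def/= expr0n addr0 sqrtr_sqr. Qed.

(** * Compact operators along summable sequences *)

Section CompactOperator.
Local Open Scope classical_set_scope.
Context {R : realType} {V : normedModType R[i]}.

(** A compact superset of [A] contains a cluster point of the sequence. Arbitrarily late indices
    near [p] replace a convergent subsequence. *)
Lemma precompact_cluster {A : set V} {x : nat -> V} :
  precompact A -> (forall n, A (x n)) ->
  exists p, forall e, 0 < e -> forall N, exists2 n, (N <= n)%N &
    rnorm (x n - p) < e.
Proof.
case=> U UA [Uc _] Ax.
have [|p [_ clp]] := Uc (x @ \oo) (fmap_proper_filter _ _).
  by exists 0%N => // n _; exact: UA.
exists p => e e0 N.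
have [||y [/= [n Nn <-] pyn]] := clp [set x n | n in [set n | (N <= n)%N]]
    (ball p e%:C%C).
- by exists N => // n Nn; exists n.
- by apply: nbhsx_ballx; rewrite ltcR.
exists n => //; move: pyn; rewrite -ball_normE /ball_/= -rnormE ltcR.
by rewrite rnorm_distrC.
Qed.

Lemma precompact_bounded {A : set V} : precompact A ->
  exists B : R, forall x, A x -> rnorm x <= B.
Proof.
move=> cA; apply: contrapT => nB.
have /choice[x xP] : forall n : nat, exists x, A x /\ n%:R < rnorm x.
  move=> n; apply: contrapT => nx; apply: nB; exists n%:R => x Ax.
  by rewrite leNgt; apply/negP => ?; apply: nx; exists x.
have [p pP] := precompact_cluster cA (fun n => (xP n).1).
(* For n > |p| + 1, a term within 1 of [p] has norm below n. *)
have [n] := pP 1 ltr01 (Num.truncn (rnorm p + 1)).+1.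
move=> ln xp; have [_] := xP n.
apply/negP; rewrite -leNgt (le_trans (rnorm_triangle _ p))//.
have : rnorm p + 1 < n%:R.
  by rewrite (lt_le_trans (truncnS_gt _))// ler_nat.
lra.
Qed.

(* If the values [K (f i)] cluster at p, then the sum of N of them stays near
   [N p]; as these sums stay in the bounded set [K ball], p must be 0. *)
Lemma compact_operator_small {K : {linear V -> V}} {f : nat -> V} {e : R} :
  compact_operator K ->
  (forall s, uniq s -> rnorm (\sum_(i <- s) f i) <= 1) ->
  0 < e -> exists i, rnorm (K (f i)) < e.
Proof.
move=> cK fs e0; have [B BP] := precompact_bounded cK.
have f1 i : (K @` [set x | rnorm x <= 1]) (K (f i)).
  by exists (f i) => //; have := fs [:: i] isT; rewrite big_seq1.
have [p pP] := precompact_cluster cK f1.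
have e20 : 0 < e / 2 by rewrite divr_gt0.
have sums N : exists s : seq nat,
    [/\ uniq s, size s = N & forall i, i \in s -> rnorm (K (f i) - p) < e / 2].
  elim: N => [|N [s [us sN sp]]]; first by exists [::].
  (* An index beyond all those in [s] keeps the list free of repetitions. *)
  have [n ln np] := pP _ e20 (\max_(i <- s) i).+1.
  exists (n :: s); split => //=; last 2 first.
  - by rewrite sN.
  - by move=> i; rewrite inE => /predU1P[->//|]; exact: sp.
  rewrite us andbT; apply/negP => ns.
  by have := leq_bigmax_seq n (F := id) ns isT; rewrite leqNgt ln.
have small : rnorm p <= e / 2.
  rewrite leNgt; apply/negP => pe.
  (* With N terms the image has norm at least N|p| - N e/2, which exceeds [B] for this N. *)
  pose N := (Num.truncn (B / (rnorm p - e / 2))).+1.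
  have [s [us sN sp]] := sums N.
  have : rnorm (K (\sum_(i <- s) f i)) <= B.
    by apply: BP; exists (\sum_(i <- s) f i) => //; exact: fs.
  apply/negP; rewrite -ltNge raddf_sum.
  have lbN : B < N%:R * (rnorm p - e / 2).
    by rewrite -ltr_pdivrMr ?subr_gt0// truncnS_gt.
  rewrite (lt_le_trans lbN)//.
  have := rnorm_triangle (p *+ N) (\sum_(i <- s) K (f i)).
  rewrite rnormMn -[rnorm p *+ N]mulr_natl => H.
  have : rnorm (p *+ N - \sum_(i <- s) K (f i)) <= N%:R * (e / 2).
    rewrite rnorm_distrC.
    have -> : p *+ N = \sum_(i <- s) p.
      by rewrite big_const_seq count_predT sN iter_addr_0.
    rewrite -sumrB (le_trans (rnorm_sum _ _ _))//.
    have -> : N%:R * (e / 2) = \sum_(i <- s) (e / 2).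
      by rewrite big_const_seq count_predT sN iter_addr_0 mulr_natl.
    by rewrite !big_seq; apply: ler_sum => i /sp/ltW.
  lra.
have [n _ np] := pP _ e20 0%N.
exists n; have := rnorm_triangle (K (f n)) p; lra.
Qed.

End CompactOperator.

(** * Levels of adjacent vertices *)

Section TreeLevel.
Context {T : rooted_tree}.
Implicit Types u v w : T.

Lemma level_root : level (root : T) = 0%N.
Proof. by rewrite -(@level_path _ root [::]). Qed.

Lemma level_gt0 {v} : (0 < level v)%N -> v != root.
Proof. by apply: contraTneq => ->; rewrite level_root. Qed.

(** The simple path from the root to [u] either avoids [v] and extends by the edge to [v], or meets
    [v] and can be cut there. *)
Lemma level_adj u v : adj u v -> (level v <= (level u).+1)%N.
Proof.
move=> uv; have [p up] := simple_path_ex root u.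
rewrite -(level_path up); case: up => pp lp unip.
have [vp|vp] := boolP (v \in root :: p); last first.
  rewrite -(@level_path _ v (rcons p v)) ?size_rcons//; split.
  - by rewrite rcons_path pp lp.
  - by rewrite last_rcons.
  - by rewrite -rcons_cons rcons_uniq vp.
move: vp; rewrite inE => /predU1P[->|vp]; first by rewrite level_root.
case/path.splitP: vp pp unip {lp} => p1 p2; rewrite cat_path => /andP[pp1 _].
rewrite -cat_cons cat_uniq => /andP[up1 _].
rewrite -(@level_path _ v (rcons p1 v)); last by split; rewrite ?last_rcons.
by rewrite size_cat leqW// leq_addr.
Qed.

Lemma level_parent {v} : v != root -> level v = (level (parent v)).+1.
Proof.
move=> /parentP[av lv]; apply/eqP; rewrite eqn_leq lv andbT.
by apply: level_adj; rewrite adj_sym.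
Qed.

End TreeLevel.

(** * Weighted derivatives and functions varying in an annulus *)

Section WeightedLipschitz.
Local Open Scope classical_set_scope.
Context {R : realType} {T : rooted_tree}.
Implicit Types (f : T -> R[i]) (v : T).

(** [parent] is not meaningful at the root, but the weight vanishes there; bounds on [wD] can thus
    range over all vertices. *)
Lemma wD_root f : wD f root = 0.
Proof. by rewrite /wD level_root mul0r. Qed.

Lemma wD_sum (I : Type) (s : seq I) (F : I -> T -> R[i]) v :
  wD (\sum_(i <- s) F i) v <= \sum_(i <- s) wD (F i) v.
Proof.
elim: s => [|i s IHs]; first by rewrite !big_nil wD0.
by rewrite !big_cons (le_trans (wDD _ _ _))// lerD2l.
Qed.

Lemma wnorm_le1 f : f root = 0 -> (forall v, wD f v <= 1) -> wnorm f <= 1.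
Proof.
move=> f0 fD; rewrite /wnorm f0 rnorm0 add0r.
by apply: ge_sup; [exact: wD_set_nonempty|move=> _ [v _ <-]].
Qed.

Lemma wD_le_wnorm f v : f \in @Lw_pred R T -> wD f v <= wnorm f.
Proof.
move=> fL; have [->|v0] := eqVneq v root.
  by rewrite wD_root addr_ge0 ?rnorm_ge0 ?sup_wD_ge0.
by rewrite (le_trans (wD_le_sup fL v0))// lerDr rnorm_ge0.
Qed.

(* Membership in the unit ball together with [f root = 0]; the variation of f
   is confined to the annulus [N <= |v| < N']. *)
Definition annular (N N' : nat) f : Prop :=
  [/\ f root = 0, forall v, wD f v <= 1 &
      forall v, wD f v != 0 -> (N <= level v < N')%N].

(** The weighted derivative is zero from level [N'] on. Annular functions thus lie in both spaces,
    so the same test functions serve for each. *)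
Lemma annular_Lw0 {N N' f} : annular N N' f -> f \in @Lw0_pred R T.
Proof.
move=> [f0 f1 fN]; apply/andP; split.
  by apply/asboolP; exists 1 => _ [v _ <-].
apply/asboolP; apply: cvg_near_cst; exists N' => // v /= lv.
apply/eqP; apply: contraTT lv => /fN/andP[_].
by rewrite ltnNge.
Qed.

(** The annuli are pairwise disjoint, so at each vertex at most one summand has a nonzero weighted
    derivative. *)
Lemma annular_sum (m : nat -> nat) (F : nat -> T -> R[i]) (s : seq nat) :
  {homo m : i j / (i <= j)%N} -> (forall i, annular (m i) (m i.+1) (F i)) ->
  uniq s -> wnorm (\sum_(i <- s) F i) <= 1.
Proof.
move=> mm aF us; apply: wnorm_le1 => [|v].
  rewrite (_ : (\sum_(i <- s) F i) root = \sum_(i <- s) F i root).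
    by rewrite big1// => i _; case: (aF i).
  by elim: s {us} => [|i s IHs]; rewrite ?big_nil// !big_cons -IHs.
rewrite (le_trans (wD_sum _ _ _ _))//.
have [/hasP[i si Fi]|/hasPn noF] := boolP (has (fun i => wD (F i) v != 0) s).
  rewrite (bigD1_seq i)//= big1 ?addr0; first by case: (aF i).
  move=> j ji; apply/eqP; apply: contra_neqT ji => Fj.
  case: (aF i) => _ _ /(_ v Fi)/andP[il lu].
  case: (aF j) => _ _ /(_ v Fj)/andP[jl ju].
  apply/eqP; rewrite eqn_leq; apply/andP; split; rewrite leqNgt; apply/negP.
  - by move=> /mm; rewrite leqNgt (leq_ltn_trans jl lu).
  - by move=> /mm; rewrite leqNgt (leq_ltn_trans il ju).
rewrite big_seq big1// => i /noF; rewrite negbK => /eqP//.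
Qed.

(** The suprema decrease with n, so their limit is their infimum, and [c] lies below each of
    them. *)
Lemma limn_ereal_sup_level {h : T -> R} {c : R} (N : nat) :
  (c%:E < limn (fun n => ereal_sup
    [set (h v)%:E | v in [set v : T | (n <= level v)%N]]))%E ->
  exists2 v, (N <= level v)%N & c < h v.
Proof.
set u := fun n => _.
have ni : nonincreasing_seq u.
  move=> m n mn; apply: ereal_sup_le => _ [v /= nv <-].
  by exists v => //=; exact: leq_trans mn nv.
rewrite (cvg_lim _ (ereal_nonincreasing_cvgn ni))// => cu.
have /ereal_sup_gt[_ [v Nv <-]] : (c%:E < u N)%E.
  by rewrite (lt_le_trans cu)//; apply: ereal_inf_lbound; exists N.
by rewrite lte_fin; exists v.
Qed.

End WeightedLipschitz.

(** * Test functions for A and B *)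

Section TestFunctions.
Context {R : realType} {T : rooted_tree}.

(** Normalised at the children of [u], where the weight is |u| + 1. *)
Definition point_mass (u v : T) : R[i] :=
  (if v == u then (level u).+1%:R^-1 else 0 : R)%:C%C.

(** Only [u] and its children carry a nonzero derivative, whence the outer radius |u| + 2. *)
Lemma annular_point_mass N (u : T) : (0 < level u)%N -> (N <= level u)%N ->
  annular N (level u).+2 (point_mass u).
Proof.
move=> u0 Nu.
have far v : wD (point_mass u) v != 0 -> (level u <= level v <= (level u).+1)%N.
  have [->|v0] := eqVneq v root; first by rewrite wD_root eqxx.
  have [->|vu] := eqVneq v u; first by rewrite leqnn leqnSn.
  have [<-|pu] := eqVneq (parent v) u.
    by rewrite (level_parent v0) leqnSn leqnn.
  rewrite /wD /Dtree /point_mass (negbTE vu) (negbTE pu) subrr rnorm0 mulr0.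
  by rewrite eqxx.
split.
- rewrite /point_mass; case: eqVneq => // ru.
  by rewrite -ru level_root in u0.
- move=> v; have [->//|/far/andP[_ lv]] := eqVneq (wD (point_mass u) v) 0.
  have D1 : Dtree (point_mass u) v <= (level u).+1%:R^-1.
    rewrite /Dtree /point_mass -rmorphB/= rnorm_real.
    have h0 : 0 <= (level u).+1%:R^-1 :> R by rewrite invr_ge0.
    by case: ifP => _; case: ifP => _; rewrite ?subrr ?subr0 ?sub0r ?normrN
       ?normr0 ?(ger0_norm h0).
  rewrite /wD (le_trans (ler_wpM2l _ D1))//.
  by rewrite ler_pdivrMr ?ltr0n// mul1r ler_nat.
- by move=> v /far/andP[lv lv']; rewrite (leq_trans Nu lv)/= ltnS.
Qed.

Lemma wD_mul_point_mass (psi : T -> R[i]) (u : T) : (0 < level u)%N ->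
  wD (fun v => psi v * point_mass u v) u =
  (level u)%:R / (level u).+1%:R * rnorm (psi u).
Proof.
move=> u0; have /parentP[_ pu] := level_gt0 u0.
rewrite /wD /Dtree /point_mass eqxx ifF; last first.
  by apply/negP => /eqP pE; rewrite pE ltnn in pu.
rewrite mulr0 subr0 rnormM rnorm_real ger0_norm ?invr_ge0//.
by rewrite -mulrA [rnorm _ * _]mulrC.
Qed.

(** The increment along an edge from level k to level k + 1; 1/(k + 1) is the largest that the
    weight k + 1 allows in the unit ball. *)
Definition harmonic_window (N n k : nat) : R :=
  if (N <= k < n)%N then k.+1%:R^-1 else 0.

Definition harmonic_radial (N n : nat) (v : T) : R[i] :=
  (series (harmonic_window N n) (level v))%:C%C.

Lemma harmonic_radial_parent N n {v} : v != root ->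
  harmonic_radial N n v - harmonic_radial N n (parent v) =
  (harmonic_window N n (level (parent v)))%:C%C.
Proof.
move=> v0; rewrite /harmonic_radial (level_parent v0) -rmorphB/=.
by rewrite /series/= big_nat_recr//= addrAC subrr add0r.
Qed.

Lemma annular_harmonic_radial N n : annular N n.+1 (harmonic_radial N n).
Proof.
split.
- by rewrite /harmonic_radial level_root /series/= big_geq.
- move=> v; have [->|v0] := eqVneq v root; first by rewrite wD_root ler01.
  rewrite /wD /Dtree harmonic_radial_parent// rnorm_real (level_parent v0).
  rewrite /harmonic_window; case: ifP => _; last by rewrite normr0 mulr0.
  by rewrite ger0_norm ?invr_ge0// mulfV ?pnatr_eq0.
- move=> v; have [->|v0] := eqVneq v root; first by rewrite wD_root eqxx.
  rewrite /wD /Dtree harmonic_radial_parent// rnorm_real.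
  rewrite /harmonic_window; case: ifP; last by rewrite normr0 mulr0 eqxx.
  move=> /andP[Nl ln] _; rewrite (level_parent v0) ltnS ln andbT.
  exact: leq_trans Nl (leqnSn _).
Qed.

(** By log(1 + x) <= x, log(m + 1) is at most the full harmonic sum; each of the min(m, N) terms
    missing from the window is at most 1. *)
Lemma ln_le_series_window N n m : (m <= n)%N ->
  ln m.+1%:R <= series (harmonic_window N n) m + (minn m N)%:R.
Proof.
elim: m => [|m IHm] mn; first by rewrite ln1 /series/= big_geq// min0n addr0.
have m0 : 0 < m.+1%:R :> R by rewrite ltr0n.
have step : ln m.+2%:R <= ln m.+1%:R + m.+1%:R^-1 :> R.
  have -> : m.+2%:R = m.+1%:R * (1 + m.+1%:R^-1) :> R.
    by rewrite mulrDr mulr1 divff ?gt_eqF// -[m.+2]addn1 natrD.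
  have i0 : 0 < m.+1%:R^-1 :> R by rewrite invr_gt0.
  rewrite lnM ?posrE ?addr_gt0// lerD2l.
  by rewrite le_ln1Dx// (lt_trans _ i0)// ltrN10.
have := IHm (ltnW mn); rewrite /series/= big_nat_recr//= => IH.
apply: (le_trans step).
rewrite /harmonic_window mn andbT; case: leqP => Nm.
  by move: IH; rewrite (minn_idPr Nm) (minn_idPr (leqW Nm)) addrAC lerD2r.
move: IH; rewrite (minn_idPl (ltnW Nm)) (minn_idPl Nm) addr0 => IH.
by rewrite -[in leRHS]natr1 addrA lerD// invf_le1// ler1n.
Qed.

Lemma wD_mul_harmonic_radial (psi : T -> R[i]) N (u : T) : (0 < level u)%N ->
  (level u)%:R * Dtree psi u * (ln (level u)%:R - N%:R) <=
  wD (fun v => psi v * harmonic_radial N (level u).-1 v) u.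
Proof.
move=> u0; have ur := level_gt0 u0; have lu := level_parent ur.
set f := harmonic_radial N (level u).-1.
(* The edge from the parent to [u] has index |u| - 1, the first one past the window; f(u) then
   factors out of the difference. *)
have fp : f (parent u) = f u.
  apply/esym/subr0_eq; rewrite /f harmonic_radial_parent// lu/=.
  by rewrite /harmonic_window ltnn andbF.
rewrite /wD /Dtree fp -mulrBl rnormM -mulrA.
rewrite ler_wpM2l// ler_wpM2l ?rnorm_ge0//.
rewrite -fp /f /harmonic_radial rnorm_real lu/=.
rewrite (le_trans _ (ler_norm _))// lerBlDr.
apply: (le_trans (ln_le_series_window N _ _ (leqnn _))).
by rewrite lerD2l ler_nat geq_minr.
Qed.

End TestFunctions.

(** * Lower bounds for the essential norm *)

Section EssentialNorm.
Local Open Scope classical_set_scope.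
Context {R : realType} {T : rooted_tree} (V : normedModType R[i]).
(** Both spaces are treated at once: [V] embeds linearly and isometrically into the functions on
    [T], with image between the little space and the full one. *)
Context (ev : {linear V -> (T -> R[i])}).
Context (norm_ev : forall x, rnorm x = wnorm (ev x)).
Context (ev_Lw : forall x, ev x \in @Lw_pred R T).
Context (ev_onto : forall f, f \in @Lw0_pred R T -> exists x, ev x = f).

(* Otherwise one could choose infinitely many functions varying in pairwise
   disjoint annuli, whose images under K all have norm at least e, although
   every finite sum of them is in the unit ball. *)
Lemma compact_operator_annular {K : {linear V -> V}} {e : R} :
  compact_operator K -> 0 < e ->
  exists N, forall N' x, annular N N' (ev x) -> rnorm (K x) < e.
Proof.
move=> cK e0; apply: contrapT => /forallNP no.
have /choice[g gP] : forall N, exists y : V * nat,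
    annular N y.2 (ev y.1) /\ e <= rnorm (K y.1).
  move=> N; have /existsNP[N' /existsNP[x /not_implyP[ax /negP]]] := no N.
  by rewrite -leNgt => ex; exists (x, N').
(* The maximum makes the radii nondecreasing without comparing N with the outer radius given by
   [g]. *)
pose m i := iter i (fun N => maxn N (g N).2) 0%N.
have mS i : m i.+1 = maxn (m i) (g (m i)).2 by [].
have mm : {homo m : i j / (i <= j)%N}.
  apply: (homo_leq leqnn (fun _ _ _ => @leq_trans _ _ _)) => i.
  by rewrite mS leq_maxl.
have aF i : annular (m i) (m i.+1) (ev (g (m i)).1).
  have [[f0 f1 fN] _] := gP (m i); split => // v /fN /andP[-> lv].
  by rewrite mS (leq_trans lv)// leq_maxr.
have [s us|i] := compact_operator_small (f := fun i => (g (m i)).1) cK _ e0.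
  by rewrite norm_ev raddf_sum; exact: (annular_sum _ _ _ mm aF us).
by apply/negP; rewrite -leNgt; have [] := gP (m i).
Qed.

Context (psi : T -> R[i]) (M : {linear V -> V}).
Context (mulM : forall x v, ev (M x) v = psi v * ev x v).

(** Test functions are required for every inner radius [N], since [K] decides how far out its values
    drop below e/2; the other e/2 is the loss allowed in reaching [c]. *)
Lemma operator_norm_lower_bound (K : {linear V -> V}) (c : R) :
  compact_operator K ->
  (forall N e, 0 < e -> exists N' f v, annular N N' f /\
    c - e <= wD (fun w => psi w * f w) v) ->
  (c%:E <= operator_norm (M \- K)%R)%E.
Proof.
move=> cK test; apply/lee_addgt0Pr => e e0.
have e20 : 0 < e / 2 by rewrite divr_gt0.
have [N NP] := compact_operator_annular cK e20.
have [N' [f [v [af lf]]]] := test N (e / 2) e20.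
have [x xf] := ev_onto _ (annular_Lw0 af).
have Kx : rnorm (K x) < e / 2 by apply: (NP N'); rewrite xf.
have x1 : rnorm x <= 1.
  by rewrite norm_ev xf; case: af => f0 f1 _; exact: wnorm_le1.
have Mx : c - e / 2 <= rnorm (M x).
  rewrite (le_trans lf)// norm_ev (le_trans _ (wD_le_wnorm _ v (ev_Lw _)))//.
  by rewrite (_ : (fun w => _) = ev (M x))//; apply/funext => w; rewrite mulM xf.
apply: (@le_trans _ _ ((rnorm ((M \- K) x))%:E + e%:E)%E).
  have := rnorm_triangle (M x) (K x).
  rewrite -EFinD lee_fin /=; lra.
by rewrite leeD2r//; apply: ereal_sup_ubound; exists x.
Qed.

Lemma Apsi_le_operator_norm (K : {linear V -> V}) (c : R) :
  compact_operator K -> 0 <= c -> (c%:E < Apsi psi)%E ->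
  (c%:E <= operator_norm (M \- K)%R)%E.
Proof.
move=> cK c0 cA; apply: operator_norm_lower_bound => // N e e0.
(* The factor |u|/(|u| + 1) costs c/(|u| + 1), which is below [e] once |u| > c/e. *)
pose n := maxn N.+1 (Num.truncn (c / e)).+1.
have [u nu cu] := limn_ereal_sup_level n cA.
have Nu : (N < level u)%N by rewrite (leq_trans _ nu)// leq_maxl.
have u0 : (0 < level u)%N by apply: leq_trans Nu.
exists (level u).+2, (point_mass u), u; split.
  by apply: annular_point_mass => //; exact: ltnW.
rewrite wD_mul_point_mass//.
have cl : c < (level u)%:R * e.
  rewrite -ltr_pdivrMr// (lt_le_trans (truncnS_gt _))// ler_nat.
  by rewrite (leq_trans _ nu)// leq_maxr.
have l1 : 0 < (level u).+1%:R :> R by rewrite ltr0n.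
rewrite mulrAC ler_pdivlMr//.
have l0 : 0 <= (level u)%:R :> R by rewrite ler0n.
rewrite -[(level u).+1]addn1 natrD.
nra.
Qed.

Lemma Bpsi_le_operator_norm (K : {linear V -> V}) (c : R) :
  compact_operator K -> 0 <= c -> (c%:E < Bpsi psi)%E ->
  (c%:E <= operator_norm (M \- K)%R)%E.
Proof.
move=> cK c0 cB; apply: operator_norm_lower_bound => // N e e0.
(* Write l = log |u| and x = |u| D psi(u), with x l > c. Then l >= L gives l > 0, l >= N and c N/l
   <= e, so x (l - N) >= c (1 - N/l) >= c - e. *)
pose L : R := N%:R + c * N%:R / e + 1.
pose n := maxn 1 (Num.truncn (expR L)).+1.
have [u nu cu] := limn_ereal_sup_level n cB.
have u0 : (0 < level u)%N by rewrite (leq_trans _ nu)// leq_maxl.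
have N0 : 0 <= N%:R :> R by rewrite ler0n.
have Le : L <= ln (level u)%:R.
  rewrite -[leLHS]expRK ler_ln ?posrE ?expR_gt0 ?ltr0n//.
  rewrite ltW// (lt_le_trans (truncnS_gt _))// ler_nat.
  by rewrite (leq_trans _ nu)// leq_maxr.
exists (level u).-1.+1, (harmonic_radial N (level u).-1), u; split.
  exact: annular_harmonic_radial.
apply: le_trans (wD_mul_harmonic_radial psi N _ u0).
have x0 : 0 <= (level u)%:R * Dtree psi u by rewrite mulr_ge0 ?rnorm_ge0.
have cxl : c < (level u)%:R * Dtree psi u * ln (level u)%:R by rewrite mulrAC.
move: Le x0 cxl; rewrite /L.
move: (_ * Dtree psi u) (ln _) (N%:R) N0 => x l k k0 Le x0 cxl.
have ck0 : 0 <= c * k / e by rewrite divr_ge0 ?mulr_ge0// ltW.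
have ck : c * k <= e * l by rewrite [e * l]mulrC -ler_pdivrMr//; lra.
have l0 : 0 < l by lra.
rewrite -(ler_pM2r l0); nra.
Qed.

Lemma essential_norm_multiplication_ge :
  (Order.max (Apsi psi) (Bpsi psi) <= essential_norm M)%E.
Proof.
apply: le_ereal_inf_tmp => _ [K cK <-].
have ge0 : (0 <= operator_norm (M \- K)%R)%E.
  apply: ereal_sup_ubound; exists 0; first by rewrite /= rnorm0.
  by rewrite raddf0 rnorm0.
(* If the operator norm were below [a], it would be finite and nonnegative, and a real c strictly
   between the two would give a contradiction; this also covers infinite [a]. *)
have from_reals (a : \bar R) :
    (forall c : R, 0 <= c -> (c%:E < a)%E ->
       (c%:E <= operator_norm (M \- K)%R)%E) ->
    (a <= operator_norm (M \- K)%R)%E.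
  move=> H; rewrite leNgt; apply/negP => la.
  have fin : operator_norm (M \- K)%R \is a fin_num.
    by rewrite ge0_fin_numE// (lt_le_trans la)// leey.
  move: H la ge0; rewrite -(fineK fin); set r := fine _ => H la.
  rewrite lee_fin => r0.
  have [c rc ca] : exists2 c, r < c & (c%:E < a)%E.
    case: a la {H} => [a| |]//; last by exists (r + 1); rewrite ?ltrDl ?ltry.
    rewrite lte_fin => ra; exists ((r + a) / 2); rewrite ?lte_fin ?midf_lt//.
  have := H c (ltW (le_lt_trans r0 rc)) ca.
  by rewrite lee_fin leNgt rc.
rewrite ge_max; apply/andP; split; apply: from_reals => c c0.
- exact: Apsi_le_operator_norm.
- exact: Bpsi_le_operator_norm.
Qed.

End EssentialNorm.

Theorem theorem8p2 (R : realType) (T : rooted_tree) (psi : T -> R[i]) :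
  (forall M : {linear Lw R T -> Lw R T},
     (forall (f : Lw R T) (v : T), M f v = psi v * f v) ->
     bounded_operator M ->
     (Order.max (Apsi psi) (Bpsi psi) <= essential_norm M)%E) /\
  (forall M : {linear Lw0 R T -> Lw0 R T},
     (forall (f : Lw0 R T) (v : T), M f v = psi v * f v) ->
     bounded_operator M ->
     (Order.max (Apsi psi) (Bpsi psi) <= essential_norm M)%E).
Proof.
split=> M mulM _.
(* The embedding is the inclusion into functions, isometric by definition of the norm. *)
- apply: (@essential_norm_multiplication_ge R T (Lw R T) \val) => //.
  + exact: Lw_funP.
  + by move=> f /andP[fL _]; exists (MkLw fL).
- apply: (@essential_norm_multiplication_ge R T (Lw0 R T) \val) => //.
  + exact: Lw0_Lw.
  + by move=> f fL; exists (MkLw0 fL).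
Qed.
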